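(* Let $n\neq-1,0$ be real and $\mu=-\frac{n+2}{n}$. The point transformation $$x'=\ln|x|,\qquad t'=t,\qquad u'=x^{-\frac2n}u$$ maps the equation $$u'_{t'}=\left({u'}^nu'_{x'}\right)_{x'}+2\,\frac{n+1}{n}\,{u'}^nu'_{x'}$$ into the equation $$u_t=\left(u^nu_x\right)_x+\frac{\mu}{x}u^nu_x .$$
   Context: Subscripts denote partial derivatives. A point transformation $x'=P(x,t)$, $t'=Q(t)$, $u'=R(x,t,u)$ ''maps an equation $E'$ for $u'(x',t')$ into an equation $E$ for $u(x,t)$'' if: whenever $(x,t)\mapsto(P(x,t),Q(t))$ is a diffeomorphism of an open set $D\subset\{x>0\}$ onto an open set $D'$, $u$ is a smooth positive function on $D$, and $u'$ is defined on $D'$ by $u'(P(x,t),Q(t))=R(x,t,u(x,t))$, then $u'$ satisfies $E'$ on $D'$ if and only if $u$ satisfies $E$ on $D$. *)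

(* Defs.v *)
(* Stdlib reals with Coquelicot. *)
From Stdlib Require Import Reals List.
From Coquelicot Require Import Coquelicot.

Open Scope R_scope.

(* A function on a set D of the plane is represented by a total function
   R -> R -> R.  Every notion below depends only on its values on D when D is
   open. *)

Definition plane : UniformSpace :=
  prod_UniformSpace R_UniformSpace R_UniformSpace.

Definition partial_x (f : R -> R -> R) : R -> R -> R :=
  fun x t => Derive (fun z => f z t) x.

Definition partial_t (f : R -> R -> R) : R -> R -> R :=
  fun x t => Derive (fun s => f x s) t.

(* Iterated partial derivatives, indexed by words: true stands for x, false
   for t. *)
Fixpoint partials (w : list bool) (f : R -> R -> R) : R -> R -> R :=
  match w with
  | nil => f
  | cons true w' => partial_x (partials w' f)
  | cons false w' => partial_t (partials w' f)
  end.

(* Smooth means C^infinity: all iterated partial derivatives, mixed ones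
   included, exist and are jointly continuous on D.  Used for open D only. *)
Definition smooth_on (D : R * R -> Prop) (f : R -> R -> R) : Prop :=
  forall (w : list bool) (x t : R), D (x, t) ->
    ex_derive (fun z => partials w f z t) x /\
    ex_derive (fun s => partials w f x s) t /\
    continuous (T := plane) (fun p => partials w f (fst p) (snd p)) (x, t).

(* (x,t) |-> (P x t, Q x t) is a diffeomorphism of D onto D', with inverse
   (y,s) |-> (X y s, T y s). *)
Definition diffeomorphism (D D' : R * R -> Prop) (P Q : R -> R -> R) : Prop :=
  smooth_on D P /\ smooth_on D Q /\
  (forall x t, D (x, t) -> D' (P x t, Q x t)) /\
  exists X T : R -> R -> R,
    smooth_on D' X /\ smooth_on D' T /\
    (forall y s, D' (y, s) -> D (X y s, T y s)) /\
    (forall x t, D (x, t) ->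
       X (P x t) (Q x t) = x /\ T (P x t) (Q x t) = t) /\
    (forall y s, D' (y, s) ->
       P (X y s) (T y s) = y /\ Q (X y s) (T y s) = s).

(* An equation is identified with the relation "u satisfies it on D". *)
Definition equation : Type := (R * R -> Prop) -> (R -> R -> R) -> Prop.

(* u_t = (u^n u_x)_x + h(x) u^n u_x for positive u and real n.
   Derive is total, so the existence of the derivatives occurring in the
   equation is part of satisfying it. *)
Definition diffusion_convection (n : R) (h : R -> R) : equation :=
  fun D u => forall x t, D (x, t) ->
    ex_derive (fun s => u x s) t /\
    ex_derive (fun z => u z t) x /\
    ex_derive (fun z => Rpower (u z t) n * partial_x u z t) x /\
    partial_t u x t =
      partial_x (fun z s => Rpower (u z s) n * partial_x u z s) x t
      + h x * (Rpower (u x t) n * partial_x u x t).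

(* The point transformation x' = P(x,t), t' = Q(t), u' = S(x,t,u) maps the
   equation E' into the equation E. *)
Definition maps_into (P : R -> R -> R) (Q : R -> R) (S : R -> R -> R -> R)
    (E' E : equation) : Prop :=
  forall (D D' : R * R -> Prop) (u u' : R -> R -> R),
    open (T := plane) D ->
    open (T := plane) D' ->
    (forall x t, D (x, t) -> 0 < x) ->
    diffeomorphism D D' P (fun _ t => Q t) ->
    smooth_on D u ->
    (forall x t, D (x, t) -> 0 < u x t) ->
    (forall x t, D (x, t) -> u' (P x t) (Q t) = S x t (u x t)) ->
    (E' D' u' <-> E D u).

(* Main.v *)
Require Import Defs.
From Stdlib Require Import Reals List Lra.
From Coquelicot Require Import Coquelicot.

Open Scope R_scope.

(** Put [c = 2/n] and [y = ln x], and fix the time.  The transformation is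
    [g y = exp (- c y) * f (exp y)], where [f] and [g] are the profiles of [u]
    and [u'].  It changes the flux [F = f^n f_x] into
    [G = g^n g_y = exp (- (1 + c) y) * F (exp y) - c * g^(n+1)]
    ([flux_log_coordinate]).  Since [(g^(n+1))_y = (n+1) G], differentiating
    once more gives
    [G_y + c (n+1) G = exp (- c y) * (F_x - (1 + c) / x * F)],
    in which [- (1 + c) = - (n+2)/n] is exactly [mu] ([flux_balance]).  The time
    derivative is also multiplied by [exp (- c y)].  Hence the residual of the
    equation for [u'] at [(y, t)] is the residual of the equation for [u] at
    [(exp y, t)] times a positive factor.

    A solution must moreover have the derivatives that its equation mentions;
    here smoothness and positivity of [u] provide them for both functions, so
    only the vanishing of the residuals has to be compared.  Finally
    [(y, t)] lies in the new domain iff [(exp y, t)] lies in the old one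
    ([image_domain]), so that both equations are tested at the same points. *)

(** * The flux in the logarithmic coordinate *)

Definition flux (n : R) (f : R -> R) (z : R) : R :=
  Rpower (f z) n * Derive f z.

Lemma is_derive_Rpower_comp (f : R -> R) (a x l : R) :
  0 < f x -> is_derive f x l ->
  is_derive (fun z => Rpower (f z) a) x (a * Rpower (f x) (a - 1) * l).
Proof.
  intros Hpos Hf.
  evar_last.
  - apply (is_derive_comp (fun w => Rpower w a) f x); [|exact Hf].
    apply is_derive_Reals, derivable_pt_lim_power, Hpos.
  - unfold scal; simpl; unfold mult; simpl. ring.
Qed.

Lemma ex_derive_flux (n : R) (f : R -> R) (x : R) :
  0 < f x -> ex_derive f x -> ex_derive (Derive f) x ->
  ex_derive (flux n f) x.
Proof.
  intros Hpos Hf Hf'.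
  apply (ex_derive_mult (fun z => Rpower (f z) n) (Derive f)); [|exact Hf'].
  eexists. apply is_derive_Rpower_comp; [exact Hpos|].
  apply Derive_correct, Hf.
Qed.

Lemma locally_exp (P : R -> Prop) (y : R) :
  locally (exp y) P -> locally y (fun z => P (exp z)).
Proof. exact (continuous_exp y P). Qed.

Lemma is_derive_log_profile (c : R) (f g : R -> R) (y : R) :
  ex_derive f (exp y) ->
  locally y (fun z => g z = exp (- c * z) * f (exp z)) ->
  is_derive g y (exp (- c * y) * (exp y * Derive f (exp y) - c * f (exp y))).
Proof.
  intros Hf Hg.
  apply is_derive_ext_loc with (fun z => exp (- c * z) * f (exp z)).
  - apply filter_imp with (2 := Hg). intros z Hz. now symmetry.
  - auto_derive; [easy|].
    change (fun x : R => f x) with f. ring.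
Qed.

(** The exponent [- (1 + 2/n)] arises because [g^n] contributes the factor
    [exp (- 2 y)], [g] itself [exp (- (2/n) y)], and the chain rule [exp y]. *)
Lemma flux_log_coordinate (n : R) (f g : R -> R) (y : R) :
  n <> 0 -> 0 < f (exp y) -> ex_derive f (exp y) ->
  locally y (fun z => g z = exp (- (2 / n) * z) * f (exp z)) ->
  flux n g y =
    exp (- (1 + 2 / n) * y) * flux n f (exp y)
    - 2 / n * Rpower (g y) (n + 1).
Proof.
  intros Hn Hpos Hf Hg.
  unfold flux at 1.
  rewrite (is_derive_unique _ _ _ (is_derive_log_profile _ _ _ _ Hf Hg)).
  pose proof (locally_singleton _ _ Hg) as Hgy. simpl in Hgy.
  assert (Hgpos : 0 < g y)
    by (rewrite Hgy; apply Rmult_lt_0_compat; [apply exp_pos|exact Hpos]).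
  rewrite Rpower_plus, Rpower_1 by exact Hgpos.
  assert (Hpow : Rpower (g y) n = exp (- 2 * y) * Rpower (f (exp y)) n).
  { rewrite Hgy, <- Rpower_mult_distr by (assumption || apply exp_pos).
    f_equal. unfold Rpower. rewrite ln_exp. f_equal. now field. }
  assert (Hexp : exp (- (1 + 2 / n) * y)
                 = exp (- 2 * y) * exp (- (2 / n) * y) * exp y).
  { rewrite <- !exp_plus. f_equal. ring. }
  rewrite Hpow, Hexp, Hgy. unfold flux. ring.
Qed.

(** Under the logarithmic change of variable the spatial part of one equation
    is a multiple of the spatial part of the other: in the derivative of
    [flux_log_coordinate] the exponential factor produces the term in [1/x],
    and the power [g^(n+1)] produces the convection term. *)
Lemma flux_balance (n : R) (f g : R -> R) (y : R) :
  n <> 0 ->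
  locally (exp y) (fun z => 0 < f z /\ ex_derive f z) ->
  ex_derive (Derive f) (exp y) ->
  locally y (fun z => g z = exp (- (2 / n) * z) * f (exp z)) ->
  is_derive (flux n g) y
    (exp (- (2 / n) * y)
       * (Derive (flux n f) (exp y)
          + - ((n + 2) / n) / exp y * flux n f (exp y))
     - 2 * ((n + 1) / n) * flux n g y).
Proof.
  intros Hn Hf Hf' Hg.
  destruct (locally_singleton _ _ Hf) as [Hpos Hd].
  pose proof (locally_singleton _ _ Hg) as Hgy. simpl in Hgy.
  assert (Hgpos : 0 < g y)
    by (rewrite Hgy; apply Rmult_lt_0_compat; [apply exp_pos|exact Hpos]).
  apply is_derive_ext_loc with
    (fun z => exp (- (1 + 2 / n) * z) * flux n f (exp z)
              - 2 / n * Rpower (g z) (n + 1)).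
  { pose proof (locally_exp _ _ Hf) as Hf2.
    pose proof (locally_locally _ _ Hg) as Hg2.
    apply filter_imp with (2 := filter_and _ _ Hf2 Hg2).
    intros z [[Hz1 Hz2] Hz3]. symmetry. now apply flux_log_coordinate. }
  pose proof (ex_derive_flux n f (exp y) Hpos Hd Hf') as HF.
  assert (HG : is_derive (fun z => Rpower (g z) (n + 1)) y
                 ((n + 1) * flux n g y)).
  { pose proof (is_derive_log_profile _ _ _ _ Hd Hg) as Hg'.
    evar_last.
    - apply is_derive_Rpower_comp; [exact Hgpos|].
      apply Derive_correct. eexists. exact Hg'.
    - unfold flux. replace (n + 1 - 1) with n by ring. ring. }
  evar_last.
  - apply (is_derive_minus
             (fun z => exp (- (1 + 2 / n) * z) * flux n f (exp z))
             (fun z => 2 / n * Rpower (g z) (n + 1))).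
    + instantiate (1 := exp (- (1 + 2 / n) * y)
        * (exp y * Derive (flux n f) (exp y)
           - (1 + 2 / n) * flux n f (exp y))).
      auto_derive; [exact HF|].
      change (fun x : R => flux n f x) with (flux n f).
      ring.
    + apply (is_derive_scal (fun z => Rpower (g z) (n + 1))). exact HG.
  - assert (Hexp : exp (- (2 / n) * y) = exp (- (1 + 2 / n) * y) * exp y).
    { rewrite <- exp_plus. f_equal. ring. }
    rewrite Hexp. unfold minus, plus, opp; simpl.
    pose proof (exp_pos y). field. split; lra.
Qed.

(** * Domains *)

Lemma open_slice_x (D : R * R -> Prop) (x t : R) :
  open (T := plane) D -> D (x, t) -> locally x (fun z => D (z, t)).
Proof.
  intros HD Hxt. destruct (HD _ Hxt) as [e He].
  exists e. intros z Hz. apply He. split; [exact Hz|apply ball_center].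
Qed.

Lemma open_slice_t (D : R * R -> Prop) (x t : R) :
  open (T := plane) D -> D (x, t) -> locally t (fun s => D (x, s)).
Proof.
  intros HD Hxt. destruct (HD _ Hxt) as [e He].
  exists e. intros s Hs. apply He. split; [apply ball_center|exact Hs].
Qed.

(** Surjectivity is where the inverse map is used: it sends [(y, t)] to a
    point of [D], whose first coordinate is positive and has logarithm [y]. *)
Lemma image_domain (D D' : R * R -> Prop) (y t : R) :
  (forall x t, D (x, t) -> 0 < x) ->
  diffeomorphism D D' (fun x _ => ln (Rabs x)) (fun _ t => t) ->
  (D' (y, t) <-> D (exp y, t)).
Proof.
  intros Hpos (_ & _ & Hto & X & T & _ & _ & Hback & _ & Hinv).
  split; intros H.
  - pose proof (Hback _ _ H) as HXT. destruct (Hinv _ _ H) as [HX HT].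
    pose proof (Hpos _ _ HXT) as HXpos.
    rewrite Rabs_pos_eq in HX by lra.
    rewrite <- HX, exp_ln by exact HXpos. rewrite <- HT at 2. exact HXT.
  - specialize (Hto _ _ H). rewrite Rabs_pos_eq, ln_exp in Hto; [exact Hto|].
    left. apply exp_pos.
Qed.

(** * Comparison of the residuals *)

Theorem mainTheorem7 :
  forall n mu : R,
    n <> -1 -> n <> 0 ->
    mu = - ((n + 2) / n) ->
    maps_into
      (fun x t => ln (Rabs x))
      (fun t => t)
      (fun x t u => Rpower x (- (2 / n)) * u)
      (diffusion_convection n (fun _ => 2 * ((n + 1) / n)))
      (diffusion_convection n (fun x => mu / x)).
Proof.
  intros n mu _ Hn Hmu D D' u u' HD HD' Hx Hdiff Hu Hupos Huu'.
  pose proof (fun y t => image_domain D D' y t Hx Hdiff) as Hdom.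
  assert (Hv : forall y t, D' (y, t) ->
            u' y t = exp (- (2 / n) * y) * u (exp y) t).
  { intros y t Hyt. apply Hdom in Hyt. pose proof (Huu' _ _ Hyt) as E.
    rewrite Rabs_pos_eq, ln_exp in E by (left; apply exp_pos).
    rewrite E. unfold Rpower. now rewrite ln_exp. }
  (* The words [nil] and [true :: nil] of the smoothness hypothesis. *)
  assert (Hux : forall x t, D (x, t) -> ex_derive (fun z => u z t) x)
    by (intros x t H; exact (proj1 (Hu nil x t H))).
  assert (Hut : forall x t, D (x, t) -> ex_derive (fun s => u x s) t)
    by (intros x t H; exact (proj1 (proj2 (Hu nil x t H)))).
  assert (Huxx : forall x t, D (x, t) ->
            ex_derive (Derive (fun z => u z t)) x)
    by (intros x t H; exact (proj1 (Hu (true :: nil)%list x t H))).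
  assert (Hvloc : forall y t, D' (y, t) -> locally y (fun z =>
            u' z t = exp (- (2 / n) * z) * u (exp z) t)).
  { intros y t H. apply filter_imp with (2 := open_slice_x _ _ _ HD' H).
    intros z. apply Hv. }
  assert (Hvt : forall y t, D' (y, t) ->
            is_derive (fun s => u' y s) t
              (exp (- (2 / n) * y) * partial_t u (exp y) t)).
  { intros y t H.
    apply is_derive_ext_loc with
      (fun s => exp (- (2 / n) * y) * u (exp y) s).
    - apply filter_imp with (2 := open_slice_t _ _ _ HD' H).
      intros s Hs. symmetry. now apply Hv.
    - apply (is_derive_scal (fun s => u (exp y) s)).
      apply Derive_correct, Hut, Hdom, H. }
  assert (Hvflux : forall y t, D' (y, t) ->
            is_derive (flux n (fun z => u' z t)) y
              (exp (- (2 / n) * y)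
                 * (Derive (flux n (fun z => u z t)) (exp y)
                    + mu / exp y * flux n (fun z => u z t) (exp y))
               - 2 * ((n + 1) / n) * flux n (fun z => u' z t) y)).
  { intros y t H. rewrite Hmu. pose proof (proj1 (Hdom _ _) H) as H'.
    apply flux_balance; [exact Hn| |exact (Huxx _ _ H')|exact (Hvloc _ _ H)].
    apply filter_imp with (2 := open_slice_x _ _ _ HD H').
    intros z Hz. split; [now apply Hupos|now apply Hux]. }
  assert (Hres : forall y t, D' (y, t) ->
    (partial_t u' y t =
       Derive (flux n (fun z => u' z t)) y
       + 2 * ((n + 1) / n) * flux n (fun z => u' z t) y <->
     partial_t u (exp y) t =
       Derive (flux n (fun z => u z t)) (exp y)
       + mu / exp y * flux n (fun z => u z t) (exp y))).
  { intros y t H.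
    pose proof (is_derive_unique _ _ _ (Hvt _ _ H) : partial_t u' y t = _)
      as Et.
    pose proof (is_derive_unique _ _ _ (Hvflux _ _ H)
                : Derive (flux n (fun z => u' z t)) y = _) as Ex.
    rewrite Et, Ex.
    pose proof (exp_pos (- (2 / n) * y)) as He.
    split; intros E.
    - apply Rmult_eq_reg_l with (exp (- (2 / n) * y)); lra.
    - rewrite E. ring. }
  split; intros HE.
  - intros x t H. split; [now apply Hut|]. split; [now apply Hux|]. split.
    + apply (ex_derive_flux n (fun z => u z t));
        [now apply Hupos|now apply Hux|now apply Huxx].
    + pose proof (exp_ln x (Hx _ _ H)) as Ex.
      rewrite <- Ex in H |- *. apply Hdom in H.
      apply (Hres _ _ H). apply (HE _ _ H).
  - intros y t H. pose proof (proj1 (Hdom _ _) H) as H'.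
    split; [eexists; exact (Hvt _ _ H)|]. split.
    { eexists. apply (is_derive_log_profile (2 / n) (fun z => u z t));
        [exact (Hux _ _ H')|exact (Hvloc _ _ H)]. }
    split; [eexists; exact (Hvflux _ _ H)|].
    apply (Hres _ _ H). apply (HE _ _ H').
Qed.
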